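(* Let $\mathcal V$ be a locally admissible unitary closed variety of noncommutative Jordan algebras over a field of characteristic $0$. Then every strongly prime Kokoris algebra $A\in\mathcal V$ is associative and commutative.
   Context: Notation: $[x,y]=xy-yx$, $(x,y,z)=(xy)z-x(yz)$. A noncommutative Jordan algebra is a (not necessarily associative) algebra satisfying $(x,y,x)=0$ and $(x^2,y,x)=0$. $A^{(+)}$ is the vector space $A$ with product $\tfrac12(xy+yx)$. A Kokoris algebra is an algebra that is flexible (satisfies $(x,y,x)=0$) and satisfies the identity $J(a,b,c)=4(a,b,c)-[[a,c],b]$, where $J(a,b,c)=[[a,b],c]+[[b,c],a]+[[c,a],b]$; equivalently, it is a flexible algebra for which $A^{(+)}$ is associative. A variety $\mathcal V$ of noncommutative Jordan algebras is locally admissible if every anticommutative algebra in $\mathcal V$ is locally nilpotent (every finitely generated subalgebra $B$ is nilpotent: for some $n$ all products of $n$ elements of $B$, with any arrangement of parentheses, vanish). A variety $\mathcal V$ is unitary closed if for any $A\in\mathcal V$ the algebra $A^{\sharp}$ obtained by adjoining an external unit element to $A$ belongs to $\mathcal V$. An algebra is prime if the product of any two nonzero ideals is nonzero. The McCrimmon radical $\mathcal M(J)$ of a Jordan algebra $J$ is the smallest ideal whose quotient has no nonzero absolute zero divisors. A prime noncommutative Jordan algebra $A$ is strongly prime if it contains no nonzero ideal $I$ with $I^{(+)}\subseteq\mathcal M(A^{(+)})$. *)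

(* Defs.v *)
From HB Require Import structures.
From mathcomp Require Import all_boot all_order all_algebra.
From mathcomp Require Import boolp classical_sets.

Set Implicit Arguments.
Unset Strict Implicit.
Unset Printing Implicit Defensive.

Import GRing.Theory.
Local Open Scope classical_set_scope.
Local Open Scope ring_scope.

(* Not necessarily associative, not necessarily unital algebras over F. *)
HB.mixin Record Lmodule_isNAAlgebra (F : fieldType) A of GRing.Lmodule F A := {
  namul : A -> A -> A;
  namul_linearl : forall z, linear (namul^~ z);
  namul_linearr : forall z, linear (namul z);
}.

#[short(type="naAlgType")]
HB.structure Definition NAAlgebra (F : fieldType) :=
  { A of GRing.Lmodule F A & Lmodule_isNAAlgebra F A }.

Reserved Notation "x ** y" (at level 40, left associativity).
Notation "x ** y" := (namul x y) : ring_scope.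

Section Identities.
Variables (F : fieldType) (A : naAlgType F).
Implicit Types x y z : A.

Definition commutator x y : A := x ** y - y ** x.

Definition associator x y z : A := (x ** y) ** z - x ** (y ** z).

Definition jacobian x y z : A :=
  commutator (commutator x y) z + commutator (commutator y z) x
  + commutator (commutator z x) y.

Definition flexible := forall x y, associator x y x = 0.

Definition noncommutative_jordan :=
  flexible /\ forall x y, associator (x ** x) y x = 0.

Definition kokoris :=
  flexible /\
  forall x y z, jacobian x y z =
                associator x y z *+ 4 - commutator (commutator x z) y.

Definition anticommutative := forall x y, x ** y = - (y ** x).

Definition na_commutative := forall x y, x ** y = y ** x.

Definition na_associative := forall x y z, (x ** y) ** z = x ** (y ** z).

End Identities.

Arguments flexible {F} A.
Arguments noncommutative_jordan {F} A.
Arguments kokoris {F} A.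
Arguments anticommutative {F} A.
Arguments na_commutative {F} A.
Arguments na_associative {F} A.

Section Substructures.
Variables (F : fieldType) (A : naAlgType F).
Implicit Types B I J : set A.

Definition subspace B :=
  [/\ B 0, forall x y, B x -> B y -> B (x + y) &
      forall (a : F) x, B x -> B (a *: x)].

Definition subalgebra B :=
  subspace B /\ forall x y, B x -> B y -> B (x ** y).

Definition ideal I :=
  subspace I /\ forall x y, I x -> I (x ** y) /\ I (y ** x).

(* The linear span of all products x ** y. *)
Definition ideal_product I J : set A :=
  smallest subspace [set x ** y | x in I & y in J].

Definition prime_algebra :=
  forall I J, ideal I -> ideal J -> I <> [set 0] -> J <> [set 0] ->
    ideal_product I J <> [set 0].

(* The values of all bracketed products of n elements of B; there are none for
   n = 0. *)
Inductive bracketed_product B : nat -> set A :=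
| bracketed_one x : B x -> bracketed_product B 1 x
| bracketed_mul m n x y :
    bracketed_product B m x -> bracketed_product B n y ->
    bracketed_product B (m + n) (x ** y).

(* The condition n > 0 is needed: without it n = 0 would always do. *)
Definition nilpotent_subalgebra B :=
  exists2 n : nat, (0 < n)%N & bracketed_product B n `<=` [set 0].

Definition locally_nilpotent :=
  forall s : seq A, nilpotent_subalgebra (smallest subalgebra [set` s]).

End Substructures.

Arguments prime_algebra {F} A.
Arguments locally_nilpotent {F} A.

Section Plus.
Variables (F : fieldType) (A : naAlgType F).

Definition plus_algebra : Type := A.
HB.instance Definition _ := GRing.Lmodule.on plus_algebra.

Definition plus_mul (x y : plus_algebra) : plus_algebra :=
  (2%:R : F)^-1 *: ((x : A) ** (y : A) + (y : A) ** (x : A)).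

Lemma plus_mulC x y : plus_mul x y = plus_mul y x.
Proof. by rewrite /plus_mul addrC. Qed.

Lemma plus_mul_linearr z : linear (plus_mul z).
Proof.
move=> a x y; rewrite /plus_mul namul_linearl namul_linearr addrACA.
by rewrite -[a *: (z ** x) + _]scalerDr [LHS]scalerDr !scalerA [a * _]mulrC.
Qed.

Lemma plus_mul_linearl z : linear (plus_mul^~ z).
Proof. by move=> a x y /=; rewrite !(plus_mulC _ z) plus_mul_linearr. Qed.

HB.instance Definition _ := Lmodule_isNAAlgebra.Build F plus_algebra
  plus_mul_linearl plus_mul_linearr.

End Plus.

Section Unitization.
Variables (F : fieldType) (A : naAlgType F).

(* The pair (a, x) stands for a 1 + x. *)
Definition unitization : Type := (F^o * A)%type.
HB.instance Definition _ := GRing.Lmodule.on unitization.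

Definition unitization_mul (u v : unitization) : unitization :=
  ((u.1 : F) * (v.1 : F),
   (u.1 : F) *: v.2 + (v.1 : F) *: u.2 + u.2 ** v.2).

Let unitization_linearl_aux (a b c d : F) (x y z : A) :
  (a * b + d) *: z + c *: (a *: x + y) + (a *: x + y) ** z =
  a *: (b *: z + c *: x + x ** z) + (d *: z + c *: y + y ** z).
Proof.
rewrite namul_linearl !scalerDr scalerDl !scalerA (mulrC c).
by rewrite (addrACA (_ *: z)) [LHS]addrACA.
Qed.

Let unitization_linearr_aux (a b c d : F) (x y z : A) :
  c *: (a *: x + y) + (a * b + d) *: z + z ** (a *: x + y) =
  a *: (c *: x + b *: z + z ** x) + (c *: y + d *: z + z ** y).
Proof.
rewrite namul_linearr !scalerDr scalerDl !scalerA (mulrC c).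
by rewrite (addrACA (_ *: x)) [LHS]addrACA.
Qed.

Lemma unitization_mul_linearl w : linear (unitization_mul^~ w).
Proof.
case: w => c z a [b x] [d y]; congr pair; last exact: unitization_linearl_aux.
by rewrite /= mulrDl -mulrA.
Qed.

Lemma unitization_mul_linearr w : linear (unitization_mul w).
Proof.
case: w => c z a [b x] [d y]; congr pair; last exact: unitization_linearr_aux.
by rewrite /= mulrDr mulrCA.
Qed.

HB.instance Definition _ := Lmodule_isNAAlgebra.Build F unitization
  unitization_mul_linearl unitization_mul_linearr.

End Unitization.

Section McCrimmon.
Variables (F : fieldType) (J : naAlgType F).

(* The quadratic operator U_z = 2 L_z^2 - L_{z^2} of a Jordan algebra. *)
Definition Uop (z x : J) : J := (z ** (z ** x)) *+ 2 - (z ** z) ** x.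

(* The quotient J / I has no nonzero absolute zero divisors, where z is an
   absolute zero divisor if U_z = 0; spelled out on representatives. *)
Definition nondegenerate_ideal (I : set J) :=
  ideal I /\ forall z, (forall x, I (Uop z x)) -> I z.

Definition mccrimmon_radical : set J := smallest nondegenerate_ideal set0.

Lemma mccrimmon_radical_nondegenerate : nondegenerate_ideal mccrimmon_radical.
Proof.
split; first split; first split.
- by move=> I [[[[]]]].
- move=> x y Mx My I HI; have [[[[_ ID _] _] _] _] := HI.
  by apply: ID; [apply: Mx | apply: My].
- by move=> a x Mx I HI; have [[[[_ _ IZ] _] _] _] := HI; apply: IZ; apply: Mx.
- move=> x y Mx; split=> I HI; have [[[_ IM] _] _] := HI;
  have [IMl IMr] := IM x y (Mx I HI); [exact: IMl | exact: IMr].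
- by move=> z Mz I HI; have [[_ In] _] := HI; apply: In => x; apply: Mz.
Qed.

End McCrimmon.

Definition strongly_prime (F : fieldType) (A : naAlgType F) :=
  [/\ noncommutative_jordan A, prime_algebra A &
      forall I : set A, ideal I ->
        I `<=` mccrimmon_radical (J := plus_algebra A) -> I = [set 0]].

Section Varieties.
Variable F : fieldType.

(* Nonassociative polynomials without constant term; 0 is 0 *: x_0. *)
Inductive napoly :=
| NAVar of nat
| NAAdd of napoly & napoly
| NAScale of F & napoly
| NAMul of napoly & napoly.

Fixpoint naeval (A : naAlgType F) (v : nat -> A) (p : napoly) : A :=
  match p with
  | NAVar i => v i
  | NAAdd p q => naeval v p + naeval v q
  | NAScale a p => a *: naeval v p
  | NAMul p q => naeval v p ** naeval v q
  end.

Definition satisfies (A : naAlgType F) (p : napoly) :=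
  forall v : nat -> A, naeval v p = 0.

Definition variety (V : naAlgType F -> Prop) :=
  exists T : set napoly, forall A, V A <-> (forall p, T p -> satisfies A p).

Definition noncommutative_jordan_variety (V : naAlgType F -> Prop) :=
  variety V /\ forall A, V A -> noncommutative_jordan A.

Definition locally_admissible (V : naAlgType F -> Prop) :=
  forall A, V A -> anticommutative A -> locally_nilpotent A.

Definition unitary_closed (V : naAlgType F -> Prop) :=
  forall A : naAlgType F, V A -> V (unitization A).

End Varieties.

(* Main.v *)
(** In a Kokoris algebra the product is xy = x.y + {x,y} with x.y associative
    and commutative and {x,-} = [x,-]/2 a derivation of it, so the nilpotent
    elements form an ideal, contained in the McCrimmon radical, hence zero.

    Fix x and let D = {x,-} on A#, and consider the anticommutative algebra
    F x + W with x w = D w and W W = 0, where W is the space of all maps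
    A# -> A# with D acting pointwise. It lies in V: evaluating an identity of
    A# at the elements a_i (x + t) + s w_i(y), s and t scalars, the part of
    degree 1 in s and of degree 0 in x + t is its value in F x + W, and it
    vanishes because polynomials over A# with infinitely many scalar roots are
    zero. Local nilpotency applied to x and the identity map of A# gives
    D^n = 0 for some n, and a nilpotent derivation of a reduced algebra of
    characteristic 0 is zero. So the bracket vanishes. *)
Require Import Defs.
From HB Require Import structures.
From mathcomp Require Import all_boot all_order all_algebra.
From mathcomp Require Import boolp classical_sets functions.
From mathcomp Require Import ring.
Set Implicit Arguments.
Unset Strict Implicit.
Unset Printing Implicit Defensive.
Import GRing.Theory.
Local Open Scope classical_set_scope.
Local Open Scope ring_scope.

(** * Additive identities by way of commutative rings *)

Section SquareZero.
Variable V : zmodType.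

(* The trivial square-zero extension of the integers by V: it turns additive
   identities in V into identities in a commutative ring, for [ring]. *)
Definition square_zero : Type := (int * V)%type.
HB.instance Definition _ := GRing.Zmodule.on square_zero.

Definition sqz_mul (x y : square_zero) : square_zero :=
  (x.1 * y.1, y.2 *~ x.1 + x.2 *~ y.1).

Lemma sqz_mulA : associative sqz_mul.
Proof.
move=> [a x] [b y] [c z]; rewrite /sqz_mul /=; congr pair; first exact: mulrA.
by rewrite !mulrzDl -!mulrzA addrA (mulrC b a) (mulrC c a).
Qed.

Lemma sqz_mulC : commutative sqz_mul.
Proof. by move=> [a x] [b y]; rewrite /sqz_mul /=;
congr pair; [exact: mulrC | exact: addrC].
Qed.

Lemma sqz_mul1 : left_id (1, 0) sqz_mul.
Proof. by move=> [a x]; rewrite /sqz_mul /= mul1r mul0rz addr0. Qed.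

Lemma sqz_mulDl : left_distributive sqz_mul +%R.
Proof.
move=> [a x] [b y] [c z]; rewrite /sqz_mul /=; congr pair; first exact: mulrDl.
by rewrite mulrzDr mulrzDl addrACA.
Qed.

Lemma sqz_nonzero : (1, 0) != 0 :> square_zero.
Proof. by []. Qed.

HB.instance Definition _ := GRing.Zmodule_isComNzRing.Build square_zero
  sqz_mulA sqz_mulC sqz_mul1 sqz_mulDl sqz_nonzero.

Definition sqz_inj (x : V) : square_zero := (0, x).

Lemma sqz_injB : zmod_morphism sqz_inj.
Proof. by move=> x y; congr pair; rewrite subr0. Qed.

HB.instance Definition _ := GRing.isZmodMorphism.Build V square_zero
  sqz_inj sqz_injB.

Lemma sqz_injI x y : sqz_inj x = sqz_inj y -> x = y.
Proof. by case. Qed.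

End SquareZero.

Ltac zmod := apply: sqz_injI; ring.

(** * Symmetrized product and bracket of a Kokoris algebra *)

Section Products.
Variables (F : fieldType) (A : naAlgType F).
Implicit Types x y z : A.

Lemma namulDl x y z : (x + y) ** z = x ** z + y ** z.
Proof. by have := namul_linearl z 1 x y; rewrite /= !scale1r. Qed.

Lemma namulDr x y z : z ** (x + y) = z ** x + z ** y.
Proof. by have := namul_linearr z 1 x y; rewrite !scale1r. Qed.

Lemma namul0l z : 0 ** z = 0.
Proof. by apply: (addIr (0 ** z)); rewrite -namulDl !add0r. Qed.

Lemma namul0r z : z ** 0 = 0.
Proof. by apply: (addIr (z ** 0)); rewrite -namulDr !add0r. Qed.

Lemma namulZl (a : F) x z : (a *: x) ** z = a *: (x ** z).
Proof. by have := namul_linearl z a x 0; rewrite /= namul0l !addr0. Qed.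

Lemma namulZr (a : F) x z : z ** (a *: x) = a *: (z ** x).
Proof. by have := namul_linearr z a x 0; rewrite namul0r !addr0. Qed.

Lemma namulNl x z : (- x) ** z = - (x ** z).
Proof. by rewrite -scaleN1r namulZl scaleN1r. Qed.

Lemma namulNr x z : z ** (- x) = - (z ** x).
Proof. by rewrite -scaleN1r namulZr scaleN1r. Qed.

Definition namulE := (namulDl, namulDr, namulNl, namulNr).

Lemma flexible_linearized x y z :
  flexible A -> associator x y z + associator z y x = 0.
Proof.
move=> flexA.
have -> : associator x y z + associator z y x =
    associator (x + z) y (x + z) - associator x y x - associator z y z.
  by rewrite /associator !namulE; zmod.
by rewrite !flexA !subr0.
Qed.

(** The defect of the Leibniz rule is a signed sum of three linearized flexibility expressions. *)
Lemma plus_mulDE x y z : flexible A ->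
  commutator x (y ** z + z ** y) =
    (commutator x y ** z + z ** commutator x y)
    + (y ** commutator x z + commutator x z ** y).
Proof.
move=> flexA; apply/eqP; rewrite -subr_eq0; apply/eqP.
transitivity (- (associator x y z + associator z y x)
  - (associator x z y + associator y z x)
  + (associator y x z + associator z x y)).
  by rewrite /associator /commutator !namulE; zmod.
by rewrite !(flexible_linearized _ _ _ flexA) oppr0 !addr0.
Qed.

Lemma kokoris_assoc x y z : kokoris A ->
  (x ** y + y ** x) ** z + z ** (x ** y + y ** x) =
  x ** (y ** z + z ** y) + (y ** z + z ** y) ** x.
Proof.
move=> [flexA kokA]; apply/eqP; rewrite -subr_eq0; apply/eqP.
pose p := associator x y z + associator z y x.
(* The difference of the two sides is the defect of the Kokoris identity, up to twice a linearized
   flexibility expression. *)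
transitivity (associator x y z *+ 4 - commutator (commutator x z) y
   - jacobian x y z - (p + p)).
  by rewrite /p /jacobian /associator /commutator !namulE; zmod.
by rewrite -kokA subrr /p !(flexible_linearized _ _ _ flexA) addr0 subrr.
Qed.

Definition half_commutator x y : A := 2^-1 *: commutator x y.

Lemma plus_mulA : kokoris A -> associative (@plus_mul F A).
Proof.
move=> kokA x y z; rewrite /plus_mul !(namulZl, namulZr) -!scalerDr.
by congr (_ *: (_ *: _)); rewrite kokoris_assoc.
Qed.

Lemma half_commutatorDl x y z :
  half_commutator (x + y) z = half_commutator x z + half_commutator y z.
Proof.
rewrite /half_commutator /commutator !namulE -scalerDr; congr (_ *: _); zmod.
Qed.

Lemma half_commutatorZl (a : F) x y :
  half_commutator (a *: x) y = a *: half_commutator x y.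
Proof.
rewrite /half_commutator /commutator namulZl namulZr -scalerBr !scalerA.
by rewrite mulrC.
Qed.

Lemma half_commutatorC x y : half_commutator x y = - half_commutator y x.
Proof. by rewrite /half_commutator /commutator -scalerN opprB. Qed.

Lemma half_commutatorxx x : half_commutator x x = 0.
Proof. by rewrite /half_commutator /commutator subrr scaler0. Qed.

Lemma half_commutatorM x y z : flexible A ->
  half_commutator x (plus_mul y z) =
  plus_mul (half_commutator x y) z + plus_mul y (half_commutator x z).
Proof.
move=> flexA.
have -> : half_commutator x (plus_mul y z) =
    2^-1 *: (2^-1 *: commutator x (y ** z + z ** y)).
  by rewrite /half_commutator /plus_mul /commutator namulZl namulZr -scalerBr.
rewrite plus_mulDE // /plus_mul /half_commutator !(namulZl, namulZr).
by rewrite -!scalerDr.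
Qed.

Lemma namul_plus_half (two0 : 2 != 0 :> F) x y :
  x ** y = plus_mul x y + half_commutator x y.
Proof.
rewrite /half_commutator /plus_mul /commutator -scalerDr.
have -> : x ** y + y ** x + (x ** y - y ** x) = (x ** y) *+ 2 by zmod.
by rewrite -scaler_nat scalerA mulVf ?scale1r.
Qed.

End Products.

(** * Passage of the Kokoris identities to the unitization *)

Section UnitizationKokoris.
Variables (F : fieldType) (A : naAlgType F).
Implicit Types u v w : unitization A.

Lemma unitization_commutator u v : commutator u v = (0, commutator u.2 v.2).
Proof.
case: u v => a x [b y]; congr pair; first by rewrite /= mulrC subrr.
rewrite /commutator /=; zmod.
Qed.

(** Scalars associate with everything, so only the components in [A] contribute. *)
Lemma unitization_associator u v w :
  associator u v w = (0, associator u.2 v.2 w.2).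
Proof.
case: u v w => a x [b y] [c z]; congr pair; first by rewrite /= mulrA subrr.
rewrite /associator /= !namulE !scalerDr !namulZl !namulZr !scalerA.
rewrite (mulrC c a) (mulrC c b); zmod.
Qed.

Lemma unitization_kokoris : kokoris A -> kokoris (unitization A).
Proof.
move=> [flexA kokA]; split=> [u v|u v w].
  by rewrite unitization_associator flexA.
rewrite /jacobian unitization_associator !unitization_commutator /=.
have -> : forall x : A, (0, x) *+ 4 = (0, x *+ 4) :> unitization A.
  by move=> x; rewrite !mulrS mulr0n; congr pair; rewrite /= !addr0.
rewrite -[associator _ _ _ *+ 4](subrK (commutator
  (commutator u.2 w.2) v.2)) -kokA.
by congr pair; rewrite /= ?addrK ?subr0 ?addr0.
Qed.

End UnitizationKokoris.

(** * The unitization as a commutative associative algebra *)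

Section DotRing.
Variables (F : fieldType) (A : naAlgType F).

(** The two proofs are parameters of the type, so that the ring instances attached to it can use
    them. *)
Definition dot_ring of kokoris A & (2 != 0 :> F) : Type :=
  plus_algebra (unitization A).

Variables (kokA : kokoris A) (two0 : 2 != 0 :> F).
Let R := dot_ring kokA two0.
HB.instance Definition _ := GRing.Lmodule.on R.

Let kokU := unitization_kokoris kokA.

Definition dot_mul (u v : R) : R := plus_mul (u : unitization A) v.

Lemma dot_mulA : associative dot_mul.
Proof. exact: plus_mulA. Qed.

Lemma dot_mulC : commutative dot_mul.
Proof. exact: plus_mulC. Qed.

Lemma dot_mul1 : left_id (((1 : F), 0) : R) dot_mul.
Proof.
move=> [a x]; apply: (scalerI two0); rewrite /dot_mul /plus_mul scalerA.
rewrite mulfV //.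
rewrite scale1r scaler_nat mulr2n; congr pair; rewrite /= ?mul1r ?mulr1 //.
by rewrite scale1r scaler0 namul0l namul0r add0r !addr0.
Qed.

Lemma dot_mulDl : left_distributive dot_mul +%R.
Proof.
move=> u v w; rewrite /dot_mul /plus_mul -scalerDr; congr (_ *: _).
by rewrite (namulDl (u : unitization A)) (namulDr (u : unitization A)) addrACA.
Qed.

Lemma dot_nonzero : ((1 : F), 0) != 0 :> R.
Proof. by apply/eqP => -[/eqP]; rewrite oner_eq0. Qed.

HB.instance Definition _ := GRing.Zmodule_isComNzRing.Build R
  dot_mulA dot_mulC dot_mul1 dot_mulDl dot_nonzero.

Lemma dot_scaleAl (a : F) (u v : R) : a *: (u * v) = (a *: u) * v.
Proof.
rewrite /GRing.mul /= /dot_mul /plus_mul.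
rewrite (namulZl a (u : unitization A)) (namulZr a (u : unitization A)).
by rewrite -scalerDr !scalerA mulrC.
Qed.

HB.instance Definition _ := GRing.Lmodule_isLalgebra.Build F R dot_scaleAl.
HB.instance Definition _ := GRing.Lalgebra_isComAlgebra.Build F R.

End DotRing.

(** * Polynomial identities and derivations in characteristic 0 *)

Section CharacteristicZero.
Variables (F : fieldType) (charF0 : [pchar F] =i pred0).

Lemma natf_neq0 n : (n.+1%:R != 0 :> F).
Proof. by rewrite ((pcharf0P F).1 charF0). Qed.

Lemma mulrSn_eq0 (V : lmodType F) (x : V) n : x *+ n.+1 = 0 -> x = 0.
Proof.
move=> x0; apply: (scalerI (natf_neq0 n)).
by rewrite scaler0 scaler_nat.
Qed.

(** Subtracting 2^n times the relation at s from the relation at 2s kills the top term and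
    multiplies each [g i] by 2^i - 2^n, which is nonzero for i < n. *)
Lemma polynomial_values_eq0 (V : lmodType F) n (g : nat -> V) :
  (forall s : F, \sum_(i < n) s ^+ i *: g i = 0) ->
  forall i, (i < n)%N -> g i = 0.
Proof.
elim: n g => // n IH g g0.
have gi0 i : (i < n)%N -> g i = 0.
  move=> i_lt; have : (2 ^+ i - 2 ^+ n : F) *: g i = 0.
    apply: (IH (fun i => (2 ^+ i - 2 ^+ n : F) *: g i)) => // s.
    have : \sum_(i < n.+1) (2 * s) ^+ i *: g i
           - 2 ^+ n *: \sum_(i < n.+1) s ^+ i *: g i = 0.
      by rewrite !g0 scaler0 subrr.
    rewrite scaler_sumr -sumrB big_ord_recr /= exprMn -scalerA subrr addr0.
    move=> H; rewrite -[RHS]H; apply: eq_bigr => j _.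
    rewrite exprMn !scalerA -scalerBl.
    by congr (_ *: _); ring.
  move/eqP; rewrite scaler_eq0 => /orP[|/eqP//].
  (* Factor 2^i - 2^n as (1 - 2^(n - i)) 2^i. *)
  rewrite -(subnK (ltnW i_lt)) exprD -[X in X - _]mul1r -mulrBl mulf_eq0.
  rewrite expf_eq0 (negbTE (natf_neq0 1)) andbF orbF.
  rewrite -oppr_eq0 opprB -natrX -(natrB _ (expn_gt0 2 _)).
  rewrite ((pcharf0P F).1 charF0) subn_eq0 -(expn0 2) leq_exp2l //.
  by rewrite leqNgt subn_gt0 i_lt.
move=> i; rewrite ltnS leq_eqVlt => /orP[/eqP->|]; last exact: gi0.
have := g0 1; rewrite big_ord_recr big1 /= => [|j _]; last first.
  by rewrite gi0 ?scaler0.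
by rewrite add0r expr1n scale1r.
Qed.

Section Algebra.
Variable R : comAlgType F.

(** [R] may have zero divisors, so counting roots is replaced by linear algebra over [F]. *)
Lemma poly_alg_eq0 (p : {poly R}) : (forall s : F, p.[s%:A] = 0) -> p = 0.
Proof.
move=> p0; apply/polyP => i; rewrite coef0.
have [i_lt|?] := ltnP i (size p); last by rewrite nth_default.
apply: (polynomial_values_eq0 (n := size p) (g := nth 0 p)) => // s.
rewrite -[RHS](p0 s) horner_coef; apply: eq_bigr => j _.
by rewrite -mulr_algr -[s%:A]/(in_alg R s) -rmorphXn.
Qed.

Lemma poly_alg_translate_eq0 (x : R) (p : {poly R}) :
  (forall s : F, p.[x + s%:A] = 0) -> p = 0.
Proof.
move=> p0; have : p \Po ('X + x%:P) = 0.
  by apply: poly_alg_eq0 => s; rewrite horner_comp !hornerE addrC.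
move=> /(congr1 (comp_poly ('X - x%:P))).
rewrite -comp_polyA comp_polyD comp_polyX comp_polyC subrK comp_polyXr.
by rewrite comp_poly0.
Qed.

Variable D : {additive R -> R}.
Hypothesis derM : forall u v, D (u * v) = D u * v + u * D v.

Lemma der1 : D 1 = 0.
Proof.
by apply: (addrI (D 1)); rewrite addr0 -{3}[1]mulr1 derM mulr1 mul1r.
Qed.

Lemma derX u n : D (u ^+ n.+1) = u ^+ n * D u *+ n.+1.
Proof.
elim: n => [|n IH]; first by rewrite expr1 expr0 mul1r.
by rewrite exprS derM IH mulrnAr mulrA -exprS (mulrC (D u)) -mulrS.
Qed.

(** The extra factor [u] avoids the exponent n - 1, so n = 0 is no exception. *)
Lemma derXM u n : D (u ^+ n) * u = u ^+ n * D u *+ n.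
Proof.
case: n => [|n]; first by rewrite expr0 der1 mul0r mulr0n.
by rewrite derX mulrnAl exprSr mulrAC.
Qed.

(* Differentiating [z ^+ m.+1 * (D z) ^+ j = 0] and multiplying by [D z] trades
   one factor [z] for two factors [D z]. *)
Lemma der_nilpotent u n : u ^+ n = 0 -> (D u) ^+ n.*2 = 0.
Proof.
move=> un0; suff H m k : u ^+ m * D u ^+ k = 0 -> D u ^+ (k + m.*2) = 0.
  by have := H n 0%N; rewrite un0 mul0r; apply.
elim: m k => [|m IH] k; first by rewrite mul1r addn0.
move=> H; rewrite doubleS !addnS -!addSn; apply: IH.
apply: (@mulrSn_eq0 R _ m).
have := congr1 (fun r => D r * D u) H; rewrite raddf0 mul0r => H1.
rewrite -[RHS]H1 derM mulrDl -(mulrA (u ^+ m.+1))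
  derXM derX -(mulrnAr (D u ^+ k)).
by rewrite (mulrA (u ^+ m.+1)) H mul0r addr0 !mulrnAl -!mulrA -exprSr -exprS.
Qed.

(** [D] acts on polynomials in [u] and [w] as w d/du; the power of [w] is there for the
    induction. *)
Lemma iter_der_pow u w n j : D u = w -> D w = 0 ->
  iter n D (u ^+ n * w ^+ j) = w ^+ (n + j) *+ n`!.
Proof.
move=> Du Dw; elim: n j => [|n IH] j; first by rewrite expr0 mul1r.
have Dwj : D (w ^+ j) = 0.
  by case: j => [|j]; rewrite ?der1 // derX Dw mulr0 mul0rn.
rewrite iterSr derM Dwj mulr0 addr0 derX Du mulrnAl -mulrA -exprS.
have -> m r : iter m D (r *+ n.+1) = iter m D r *+ n.+1.
  by elim: m => //= m ->; rewrite raddfMn.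
by rewrite IH addnS addSn factS mulnC mulrnA.
Qed.

Lemma der_horner (p : {poly R}) z :
  D p.[z] = (map_poly D p).[z] + p^`().[z] * D z.
Proof.
elim/poly_ind: p => [|p c IH].
  by rewrite map_poly0 deriv0 !horner0 raddf0 mul0r addr0.
rewrite hornerMXaddC raddfD derM IH derivD derivC derivM derivX mulr1 addr0.
have -> : map_poly D (p * 'X + c%:P) = map_poly D p * 'X + (D c)%:P.
  apply/polyP => i; rewrite coef_map !coefD !coefMX !coefC.
  by case: i => [|i] /=; rewrite ?coef_map ?raddfD ?raddf0 //.
rewrite !(hornerE, hornerMXaddC); ring.
Qed.

End Algebra.
End CharacteristicZero.

(** * Anticommutative extensions by a linear operator *)

Section DerivationExtension.
Variables (F : fieldType) (M : lmodType F).

(* The split extension of the zero-product algebra M by a line acting by D;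
   its element (a, w) stands for a x + w with x w = - w x = D w. *)
Definition derivation_ext of {linear M -> M} : Type := (F^o * M)%type.

Variable D : {linear M -> M}.
Let B := derivation_ext D.
HB.instance Definition _ := GRing.Lmodule.on B.

Definition dext_mul (u v : B) : B :=
  (0, (u.1 : F) *: D v.2 - (v.1 : F) *: D u.2).

Lemma dext_anticommutative u v : dext_mul u v = - dext_mul v u.
Proof. by congr pair; rewrite /= ?oppr0 // opprB. Qed.

Lemma dext_mul_linearr w : linear (dext_mul w).
Proof.
move=> a u v; congr pair; rewrite /= ?scaler0 ?addr0 // linearP.
rewrite scalerDr scalerDl.
by rewrite scalerBr !scalerA opprD addrACA (mulrC a w.1).
Qed.

Lemma dext_mul_linearl w : linear (dext_mul^~ w).
Proof.
move=> a u v /=; rewrite !(dext_anticommutative _ w) dext_mul_linearr.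
by rewrite opprD scalerN.
Qed.

HB.instance Definition _ := Lmodule_isNAAlgebra.Build F B
  dext_mul_linearl dext_mul_linearr.

Lemma dext_locally_nilpotent : locally_nilpotent B ->
  forall w, exists n, iter n D w = 0.
Proof.
move=> /[swap] w /(_ [:: (1, 0) : B; (0, w) : B]) [[|n] // _ nilB].
(* The right-normed product x(x(...(x w))) with n factors x has n + 1 factors in all and equals D^n
   w. *)
exists n; set S := smallest _ _ in nilB.
have Sgen b : b \in [:: (1, 0) : B; (0, w) : B] -> S b.
  by move=> bs C [_]; apply.
suff : bracketed_product S n.+1 ((0, iter n D w) : B).
  by move=> /nilB; case.
elim: (n) => [|k IH].
  by apply: bracketed_one; apply: Sgen; rewrite !inE eqxx orbT.
have -> : (0, iter k.+1 D w) = ((1, 0) : B) ** ((0, iter k D w) : B).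
  by congr pair; rewrite /= scale1r scale0r subr0.
apply: (bracketed_mul (m := 1)) => //; apply: bracketed_one.
by apply: Sgen; rewrite !inE eqxx.
Qed.

End DerivationExtension.

(** * The bracket as a derivation of the commutative product *)

Section HalfCommutatorDerivation.
Variables (F : fieldType) (A : naAlgType F).
Variables (kokA : kokoris A) (two0 : 2 != 0 :> F).
Local Notation U := (unitization A).
Local Notation R := (dot_ring kokA two0).
Implicit Types x y z : R.

Definition ham x y : R := half_commutator (x : U) y.

Lemma ham_linear x : linear (ham x).
Proof.
move=> a y z; rewrite /ham !(half_commutatorC (x : U)).
by rewrite half_commutatorDl half_commutatorZl opprD scalerN.
Qed.

HB.instance Definition _ x := GRing.isLinear.Build F R R *:%R (ham x)
  (ham_linear x).

Lemma hamC x y : ham x y = - ham y x.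
Proof. exact (half_commutatorC (x : U) y). Qed.

Lemma hamxx x : ham x x = 0.
Proof. exact (half_commutatorxx (x : U)). Qed.

Lemma hamM x y z : ham x (y * z) = ham x y * z + y * ham x z.
Proof.
exact (half_commutatorM (x : U) y z (unitization_kokoris kokA).1).
Qed.

Lemma ham_alg x (a : F) : ham x a%:A = 0.
Proof. by rewrite linearZ /= (der1 (D := ham x)) ?scaler0 //; exact: hamM. Qed.

Lemma unitization_dot x y : (x : U) ** (y : U) = x * y + ham x y :> R.
Proof. exact (namul_plus_half two0 (x : U) y). Qed.

End HalfCommutatorDerivation.

(** * Identities of the unitization hold in the extension *)

Section Specialization.
Variables (F : fieldType) (charF0 : [pchar F] =i pred0).
Variables (A : naAlgType F) (kokA : kokoris A).
Let two0 : 2 != 0 :> F := natf_neq0 charF0 1.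
Local Notation U := (unitization A).
Local Notation R := (dot_ring kokA two0).
Local Notation "x *' y" := (((x : U) ** (y : U)) : R)
  (at level 40, left associativity) : ring_scope.

(** The product of [U] is only [F]-bilinear, so multiplication in [{poly R}] does not represent it;
    [K] is built from products of coefficients. *)
Lemma poly_namul (G H : {poly R}) : exists K : {poly R},
  [/\ K`_0 = G`_0 *' H`_0, K`_1 = G`_0 *' H`_1 + G`_1 *' H`_0 &
      forall s : F, K.[s%:A] = G.[s%:A] *' H.[s%:A]].
Proof.
(* The case of a constant left factor. *)
have const (c : R) (L : {poly R}) : exists K : {poly R},
    (forall i, K`_i = c *' L`_i) /\ forall s : F, K.[s%:A] = c *' L.[s%:A].
  elim/poly_ind: L => [|L d [K [coefK evalK]]].
    exists 0; split=> [i|s]; rewrite ?coef0 ?horner0 /=; symmetry;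
      exact (namul0r (c : U)).
  exists (K * 'X + (c *' d)%:P); split=> [i|s].
    rewrite !coefD !coefMX !coefC; case: i => [|i] /=; first by rewrite !add0r.
    by rewrite !addr0.
  rewrite !hornerMXaddC evalK !mulr_algr.
  by symmetry; rewrite (namulDr (_ : U)) (namulZr s (_ : U)).
elim/poly_ind: G => [|G c [K [K0 K1 evalK]]].
  exists 0; split=> [||s]; rewrite ?coef0 ?horner0 /=; symmetry.
  - exact (namul0l (H`_0 : U)).
  - by rewrite (namul0l (H`_1 : U)) (namul0l (H`_0 : U)) addr0.
  - exact (namul0l (_ : U)).
have [L [coefL evalL]] := const c H.
exists (K * 'X + L); split=> [||s].
- by rewrite !coefD !coefMX !coefC /= coefL !add0r.
- by rewrite !coefD !coefMX !coefC /= coefL K0 add0r addr0 addrC.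
- rewrite hornerD hornerMX evalK evalL hornerMXaddC !mulr_algr.
  by symmetry; rewrite (namulDl (_ : U)) (namulZl s (_ : U)).
Qed.

Variable x : R.

(** Acting on maps rather than on [R] makes the nilpotency exponent uniform: its value at the single
    map [id] serves every element of [R]. *)
Definition ham_comp (w : R -> R) : R -> R := ham x \o w.

Lemma ham_comp_linear : linear ham_comp.
Proof.
by move=> a v w; apply/funext => y; exact (ham_linear x a (v y) (w y)).
Qed.

HB.instance Definition _ := GRing.isLinear.Build F (R -> R) (R -> R) *:%R
  ham_comp ham_comp_linear.

Definition ham_ext : Type :=
  derivation_ext (ham_comp : {linear (R -> R) -> R -> R}).
HB.instance Definition _ := NAAlgebra.on ham_ext.

Let X (t : F) : R := x + t%:A.

Lemma ham_X t : ham x (X t) = 0.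
Proof. by rewrite raddfD /= hamxx ham_alg addr0. Qed.

(** The chain rule for the derivation [ham y], which kills the scalar coefficients of [P]; the shift
    by t does not affect the bracket. *)
Lemma ham_polyl t (P : {poly F}) y :
  ham (map_poly (in_alg R) P).[X t] y =
  (map_poly (in_alg R) P^`()).[X t] * ham x y.
Proof.
rewrite hamC (der_horner (@hamM _ _ _ _ y)).
have -> : map_poly (ham y) (map_poly (in_alg R) P) = 0.
  by apply/polyP => i; rewrite !coef_map coef0; exact: ham_alg.
rewrite horner0 add0r deriv_map raddfD /= ham_alg addr0 (hamC y x).
by rewrite mulrN opprK.
Qed.

Lemma ham_polyr t (Q : {poly R}) : ham x Q.[X t] = (map_poly (ham x) Q).[X t].
Proof. by rewrite (der_horner (@hamM _ _ _ _ x)) /= ham_X mulr0 addr0. Qed.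

(* P and Q record the constant and the linear term in s of the value of p at
   a_i X_t + s w_i(y), as polynomials in X_t = x + t: modulo X_t these values
   multiply as in the split extension. *)
Lemma naeval_ham_ext (v : nat -> ham_ext) y (p : napoly F) :
  exists (P : {poly F}) (Q : {poly R}),
  [/\ P`_0 = 0, P`_1 = (naeval v p).1, Q`_0 = (naeval v p).2 y &
   forall t, exists K : {poly R},
   [/\ K`_0 = (map_poly (in_alg R) P).[X t], K`_1 = Q.[X t] &
    forall s : F, K.[s%:A] =
      naeval (A := U) (fun i => ((v i).1 : F) *: X t + s *: (v i).2 y) p]].
Proof.
elim: p => [i|p [P [Q [P0 P1 Q0 evalp]]] q [P' [Q' [P0' P1' Q0' evalq]]]
           |a p [P [Q [P0 P1 Q0 evalp]]]
           |p [P [Q [P0 P1 Q0 evalp]]] q [P' [Q' [P0' P1' Q0' evalq]]]] /=.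
- exists (((v i).1 : F) *: 'X), ((v i).2 y)%:P.
  split=> [|||t]; rewrite ?coefZ ?coefX ?mulr0 ?mulr1 ?coefC //.
  exists ((((v i).1 : F) *: X t)%:P + ((v i).2 y)%:P * 'X); split=> [||s].
  + rewrite coefD coefMX !coefC addr0 /= map_polyZ map_polyX hornerZ hornerX.
    by rewrite mulr_algl.
  + by rewrite coefD coefMX !coefC add0r hornerC.
  + by rewrite hornerD hornerMX !hornerC mulr_algr.
- exists (P + P'), (Q + Q'); split=> [|||t];
    rewrite ?coefD ?P0 ?P1 ?Q0 ?P0' ?P1' ?Q0' ?addr0 //.
  have [K [K0 K1 evalK]] := evalp t; have [L [L0 L1 evalL]] := evalq t.
  exists (K + L); split=> [||s].
  + by rewrite coefD K0 L0 rmorphD hornerD.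
  + by rewrite coefD K1 L1 hornerD.
  + by rewrite hornerD evalK evalL.
- exists (a *: P), (a%:A *: Q); split=> [|||t];
    rewrite ?coefZ ?P0 ?P1 ?Q0 ?mulr0 ?mulr_algl //.
  have [K [K0 K1 evalK]] := evalp t.
  exists (a%:A *: K); split=> [||s].
  + by rewrite coefZ K0 map_polyZ hornerZ.
  + by rewrite coefZ K1 hornerZ.
  + by rewrite hornerZ evalK mulr_algl.
- pose f := map_poly (in_alg R).
  (* The last two terms are the brackets of [P] with [Q'] and of [Q] with [P'] at X_t, by the chain
     rule. Here [P'] and [Q'] belong to [q]; derivatives are written with [deriv]. *)
  exists (P * P'), (f P * Q' + f P' * Q
    + (f P^`() * map_poly (ham x) Q' - f P'^`() * map_poly (ham x) Q)).
  split=> [|||t].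
  + by rewrite coef0M P0 mul0r.
  + by rewrite coefM big_ord_recl big_ord1 /= P0 P0' mul0r mulr0 addr0.
  (* At degree 0 the products with [P] and [P'] vanish, and the derivatives leave [P1] and [P1']:
     this is the product of the extension. *)
  + rewrite !(coefD, coefN, coef0M, coef_map) /= !coef_deriv.
    rewrite P0 P0' P1 P1' Q0 Q0'.
    by rewrite !mulr1n scale0r !mul0r !add0r !mulr_algl.
  have [K [K0 K1 evalK]] := evalp t; have [L [L0 L1 evalL]] := evalq t.
  have [N [N0 N1 evalN]] := poly_namul K L.
  exists N; split=> [||s].
  + rewrite N0 K0 L0 unitization_dot ham_polyl hamC ham_polyl hamxx.
    by rewrite mulr0 oppr0 mulr0 addr0 rmorphM hornerM.
  + rewrite N1 K0 K1 L0 L1 !unitization_dot ham_polyl (hamC Q.[_]) ham_polyl.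
    rewrite !ham_polyr.
    rewrite !(hornerD, hornerN, hornerM) -/f; ring.
  + by rewrite evalN evalK evalL.
Qed.

Lemma satisfies_ham_ext (p : napoly F) : satisfies U p -> satisfies ham_ext p.
Proof.
move=> Up v.
have H y : (naeval v p).1 = 0 /\ (naeval v p).2 y = 0.
  have [P [Q [P0 P1 Q0 evalp]]] := naeval_ham_ext v y p.
  have {}evalp t : (map_poly (in_alg R) P).[X t] = 0 /\ Q.[X t] = 0.
    have [K [<- <- evalK]] := evalp t.
    have -> : K = 0.
      by apply: (poly_alg_eq0 charF0) => s; rewrite evalK; exact: Up.
    by rewrite !coef0.
  (* [P] and [Q] were chosen before t, so t may now vary. *)
  have P_eq0 : map_poly (in_alg R) P = 0.
    by apply: (poly_alg_translate_eq0 charF0 (x := x)) => t; have [] := evalp t.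
  have Q_eq0 : Q = 0.
    by apply: (poly_alg_translate_eq0 charF0 (x := x)) => t; have [] := evalp t.
  rewrite -P1 -Q0 Q_eq0 coef0; split=> //.
  apply: (fmorph_inj (in_alg R)).
  by rewrite -coef_map P_eq0 coef0 rmorph0.
rewrite [LHS]surjective_pairing; congr pair; first by have [] := H 0.
by apply/funext => y; have [] := H y.
Qed.

End Specialization.

(** * Nilpotent elements and nilpotent brackets *)

Section Reducedness.
Variables (F : fieldType) (charF0 : [pchar F] =i pred0).
Variables (A : naAlgType F) (kokA : kokoris A).
Let two0 : 2 != 0 :> F := natf_neq0 charF0 1.
Local Notation U := (unitization A).
Local Notation R := (dot_ring kokA two0).

Definition embed (a : A) : R := (0, a).

Lemma embedM a b : embed (a ** b) = embed a * embed b + ham (embed a) (embed b).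
Proof.
rewrite -unitization_dot; congr pair; first by rewrite /= mul0r.
by rewrite /= !scale0r !add0r.
Qed.

Lemma embedD a b : embed (a + b) = embed a + embed b.
Proof. by congr pair; rewrite /= addr0. Qed.

Lemma embedZ c a : embed (c *: a) = c *: embed a.
Proof. by congr pair; rewrite /= scaler0. Qed.

Lemma ham_embed (u v : R) : ham u v = embed (half_commutator u.2 v.2).
Proof.
by rewrite /ham /half_commutator (unitization_commutator (u : U)) embedZ.
Qed.

Lemma embed_plus_mul a b : embed (plus_mul a b) = embed a * embed b.
Proof.
apply: (addIr (ham (embed a) (embed b))); rewrite -embedM ham_embed -embedD.
by rewrite -namul_plus_half.
Qed.

Lemma nilpotentD (u v : R) m n :
  u ^+ m = 0 -> v ^+ n = 0 -> (u + v) ^+ (m + n) = 0.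
Proof.
move=> um vn; rewrite exprDn big1 // => i _.
have [lt_im|le_mi] := ltnP i n; last first.
  by rewrite -(subnK le_mi) (exprD v) vn mulr0 mulr0 mul0rn.
rewrite -addnBA; last exact: ltnW.
by rewrite (exprD u) um !mul0r mul0rn.
Qed.

Definition nil_elements : set A := [set a | exists n, embed a ^+ n = 0].

(** A product is a dot product plus a bracket; the bracket with a nilpotent element is nilpotent by
    [der_nilpotent]. *)
Lemma nil_elements_ideal : ideal nil_elements.
Proof.
have hamN (u v : R) m : u ^+ m = 0 -> ham v u ^+ m.*2 = 0.
  exact: (der_nilpotent charF0 (@hamM _ _ _ _ v)).
have mulN (u v : R) m : u ^+ m = 0 -> (u * v) ^+ m = 0.
  by move=> um; rewrite exprMn um mul0r.
have nilD u v : (exists m, u ^+ m = 0 :> R) -> (exists m, v ^+ m = 0) ->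
  exists m, (u + v) ^+ m = 0.
  by move=> [m um] [n vn]; exists (m + n)%N; exact: nilpotentD.
split; first split.
- by exists 1%N.
- by move=> x y nx ny; rewrite /nil_elements /= embedD; exact: nilD.
- by move=> c x [n xn]; exists n; rewrite embedZ exprZn xn scaler0.
- move=> x y [n xn]; split; rewrite /nil_elements /= embedM.
    rewrite hamC; apply: nilD; first by exists n; exact: mulN.
    by exists n.*2; rewrite exprNn hamN ?mulr0.
  by apply: nilD; [exists n; rewrite mulrC; exact: mulN|exists n.*2; exact: hamN].
Qed.

Lemma nil_elements_mccrimmon :
  nil_elements `<=` mccrimmon_radical (J := plus_algebra A).
Proof.
move=> a [n an] I [[[[I0 _ _] IM] In] _].
(* With exponent 2^n, induction passes from the square of [a] to [a]: by associativity U_a x =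
   (a.a).x, so [a] lies in [I] once a.a does. *)
have {}an : embed a ^+ (2 ^ n) = 0.
  by rewrite -(subnK (ltnW (ltn_expl n (isT : 1 < 2)%N))) exprD an mulr0.
elim: n a an => [|k IH] a; first by rewrite expr1 => -[->].
rewrite expnS exprM expr2 -embed_plus_mul => /IH Iaa.
apply: In => x.
have -> : Uop (a : plus_algebra A) x = plus_mul (plus_mul a a) x.
  by rewrite /Uop /namul /= (plus_mulA kokA) mulr2n addrK.
by have [] := IM (plus_mul a a : plus_algebra A) x Iaa.
Qed.

Lemma reduced a n : strongly_prime A -> embed a ^+ n = 0 -> a = 0.
Proof.
move=> [_ _ noideal] an.
have := noideal _ nil_elements_ideal nil_elements_mccrimmon.
by move=> /(congr1 (fun S : set A => S a)) /= <-; exists n.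
Qed.

Lemma nilpotent_ham_eq0 (x : R) n : strongly_prime A ->
  (forall y, iter n (ham x) y = 0) -> forall y, ham x y = 0.
Proof.
move=> primeA; elim: n => [|[|m] IH] nil_ham y;
  [exact: nil_ham | exact: nil_ham |].
(* Applying D^(m+2) = 0 to u^(m+2) gives (m+2)! w^(m+2) = 0. *)
apply: IH => {}y; pose u := iter m (ham x) y; pose w := ham x u.
have : w ^+ m.+2 = 0.
  apply: (mulrSn_eq0 charF0 (n := (m.+2)`!.-1)); rewrite prednK ?fact_gt0 //.
  rewrite -{1}[m.+2]addn0 -(iter_der_pow (@hamM _ _ _ _ x) (u := u)) //.
  exact: (nil_ham y).
(* [reduced] concerns [A] only, but brackets have no scalar part. *)
by rewrite /= -/u -/w [w]ham_embed => /(reduced primeA) ->.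
Qed.

End Reducedness.

(** * Vanishing of the bracket *)

Theorem theorem3p5 (F : fieldType) (charF0 : [pchar F] =i pred0)
    (V : naAlgType F -> Prop)
    (V_ncj : noncommutative_jordan_variety V)
    (V_adm : locally_admissible V)
    (V_unit : unitary_closed V)
    (A : naAlgType F) (VA : V A)
    (A_prime : strongly_prime A) (A_kokoris : kokoris A) :
  na_associative A /\ na_commutative A.
Proof.
have [[T VT] _] := V_ncj; have two0 := natf_neq0 charF0 1.
have half_commutator0 (a b : A) : half_commutator a b = 0.
  pose x := embed charF0 A_kokoris a.
  have Vx : V (ham_ext x).
    apply/VT => p Tp; apply: satisfies_ham_ext.
    by move: (V_unit _ VA) => /VT; apply.
  have /dext_locally_nilpotent/(_ id) [n nil_id] :=
    V_adm _ Vx (@dext_anticommutative _ _ _).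
  have nil_ham y : iter n (ham x) y = 0.
    (* Evaluate the equality of maps [nil_id] at [y]. *)
    rewrite -[RHS]/((0 : dot_ring A_kokoris _ -> dot_ring A_kokoris _) y).
    rewrite -nil_id.
    by elim: (n) => //= k ->.
  have := nilpotent_ham_eq0 A_prime nil_ham (embed charF0 A_kokoris b).
  by rewrite ham_embed => -[].
have mulE (a b : A) : a ** b = plus_mul a b.
  by rewrite namul_plus_half // half_commutator0 addr0.
split=> [a b c|a b]; rewrite !mulE; last exact: plus_mulC.
by rewrite plus_mulA.
Qed.
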